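(* Fix an integer $n \geq 3$ and real numbers $0<s_n<\cdots<s_2<s_1<\infty$, and let $S=\{s_n,\dots,s_1\}$. There exists a probability measure $\mu$ supported on $S$ such that $\mu(s_2)<\mu(s_1)$ and $$\mathbf{P}[b_1\text{ survives}\mid s(b_1)=s_2]>0$$ in the $(S,\mu)$-bullet process.
   Context: $(S,\mu)$-bullet process: $S\subseteq(0,\infty)$ is a set of speeds and $\mu$ a probability measure on $S$; $\mu(s)$ abbreviates $\mu(\{s\})$. Bullets $b_1,b_2,\dots$ are fired from the origin along the positive real line, with $b_i$ fired at time $i$. The speed of $b_i$ is $s(b_i)$, and the speeds are i.i.d. with law $\mu$. As long as it has not been annihilated, $b_i$ is at position $s(b_i)(t-i)$ at time $t\ge i$. When two or more bullets collide (are at the same position at the same time), all of them are annihilated (removed). Conditioning on $s(b_1)=s_2$ means that $b_1$ has speed $s_2$ and the other speeds are i.i.d. with law $\mu$. For $i>j$ write $b_i\mapsto b_j$ (''$b_i$ catches $b_j$'') for the event that $b_i$ and $b_j$ collide, with $b_i$ the faster one, resulting in their mutual annihilation. We say $b_1$ survives if there is no index $i$ with $b_i\mapsto b_1$. *)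

(* Defs.v *)
From HB Require Import structures.
From mathcomp Require Import all_boot all_order all_algebra.
From mathcomp Require Import all_classical all_reals all_analysis.

Set Implicit Arguments.
Unset Strict Implicit.
Unset Printing Implicit Defensive.

Import Order.TTheory GRing.Theory Num.Theory.

Local Open Scope classical_set_scope.
Local Open Scope ring_scope.

Section Dynamics.
Variable R : realType.

(* [v i] is the speed of the bullet fired at time [i]; bullets are numbered
   from 1, so [v 0] is never used. *)
Implicit Types (v : nat -> R) (i j k : nat) (t u : R).

Definition fired i t : Prop := (0 < i)%N /\ i%:R <= t.

(* Position at time [t], ignoring annihilations. *)
Definition position v i t : R := v i * (t - i%:R).

Definition meet v i k t : Prop :=
  [/\ i <> k, fired i t, fired k t & position v i t = position v k t].

(* [alive v i t]: bullet [i] is not annihilated strictly before time [t];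
   [annihilated v i t]: it is annihilated strictly before time [t].
   The rule "bullets that meet while alive are annihilated" defines the state
   at time [t] from the states at earlier times.  It is written as a mutual
   induction because the absence of a collision has to appear positively: at
   every earlier meeting, the other bullet had already been annihilated.
   For positive speeds only finitely many meetings take place before any given
   time, so exactly one of the two predicates holds. *)
Inductive alive v : nat -> R -> Prop :=
| Alive i t :
    (forall k u, u < t -> meet v i k u -> annihilated v k u) -> alive v i t
with annihilated v : nat -> R -> Prop :=
| Annihilated i k t u :
    u < t -> meet v i k u -> alive v i u -> alive v k u -> annihilated v i t.

Definition collide v i j t : Prop :=
  [/\ meet v i j t, alive v i t & alive v j t].

(* b_i |-> b_j *)
Definition catches v i j : Prop :=
  [/\ (j < i)%N, v j < v i & exists t, collide v i j t].

Definition survives v j : Prop := ~ exists i, catches v i j.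

End Dynamics.

Section RandomSpeeds.
Context (R : realType) (d : measure_display) (T : measurableType d).
Variable P : probability T R.
Implicit Type X : nat -> {RV P >-> R}.

(* Mutual independence of the family (X i)_{i in I}. *)
Definition independent_RVs (I : set nat) X : Prop :=
  forall (J : seq nat) (A : nat -> set R),
    uniq J -> [set` J] `<=` I -> (forall i, measurable (A i)) ->
    P (\bigcap_(i in [set` J]) (X i @^-1` A i)) =
    (\prod_(i <- J) P (X i @^-1` A i))%E.

(* The speeds of the (S, mu)-bullet process conditioned on s(b_1) = a: bullet 1
   has speed [a] almost surely, and the other speeds are i.i.d. with law [mu].
   For mu {a} > 0 this is the law of the i.i.d. speeds under the elementary
   conditional probability P[. | s(b_1) = a]. *)
Definition conditioned_speeds (S : set R) (mu : probability R R) (a : R) X :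
    Prop :=
  [/\ forall i w, (0 < i)%N -> S (X i w),
      P (X 1%N @^-1` [set a]) = 1%E,
      forall i, (1 < i)%N ->
        forall B, measurable B -> distribution P (X i) B = mu B
    & independent_RVs [set i | (1 < i)%N] X].

End RandomSpeeds.

(* Main.v *)
Require Import Defs.
From HB Require Import structures.
From mathcomp Require Import all_boot all_order all_algebra.
From mathcomp Require Import all_classical all_reals all_analysis.
From mathcomp Require Import ring lra zify.

Set Implicit Arguments.
Unset Strict Implicit.
Unset Printing Implicit Defensive.

Import Order.TTheory GRing.Theory Num.Theory.

(* Take mu with mass 63/64 at s_3 and 1/64 at s_1.  If b_1 has speed s_2, only
   a bullet b_i of speed s_1 can catch it.  Nothing overtakes b_i, so every
   bullet of speed s_3 fired between b_1 and b_i has been annihilated before b_i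
   reaches it, by a bullet of another speed fired in the same interval, and
   distinct bullets of speed s_3 are annihilated by distinct ones.  Hence most
   of b_2, ..., b_i do not have speed s_3.  A union bound over the subsets of
   {2, ..., m + 2} containing more than half of its m + 1 elements shows that
   this happens for i = m + 2 with probability at most
   2^(m+1) (1/8)^(m+1) <= (1/2) (1/2)^(m+1), and these bounds add up to at most
   1/2. *)

Local Open Scope classical_set_scope.
Local Open Scope ring_scope.

(* Collisions: consistency, locality and the pairing of bullets *)
Scheme alive_mut := Induction for alive Sort Prop
with annihilated_mut := Induction for annihilated Sort Prop.

Section Dynamics.
Variable R : realType.
Implicit Types (v : nat -> R) (i j k : nat) (t u : R).

Lemma alive_annihilated v i k t u : alive v i t -> u < t -> meet v i k u ->
  annihilated v k u.
Proof. by case=> {}i {}t; apply. Qed.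

(** By mutual induction: annihilating [i] takes a partner alive at their meeting, while [i] alive at
    a later time forces that partner to be annihilated already. *)
Lemma alive_not_annihilated v i t : alive v i t -> ~ annihilated v i t.
Proof.
move=> al; apply: (alive_mut (v := v) (P := fun i t _ => ~ annihilated v i t)
  (P0 := fun i t _ => ~ alive v i t)) al => {i t}.
- move=> i t ann Nal H; case: H ann Nal => {}i k {}t u ut mt _ alk ann Nal.
  exact: (Nal k u ut mt).
- move=> i k t u ut mt _ _ _ Nannk ali.
  exact/Nannk/(alive_annihilated ali ut mt).
Qed.

Lemma annihilatedP v i t : annihilated v i t ->
  exists k u, [/\ u < t, meet v i k u, alive v i u & alive v k u].
Proof. by case=> {}i k {}t u *; exists k, u. Qed.

Lemma meet_sym v i k t : meet v i k t -> meet v k i t.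
Proof. by case=> ik fi fk e; split=> // ki; exact/ik. Qed.

Lemma eq_meet v v' i k t : (forall j, fired j t -> v' j = v j) ->
  meet v i k t -> meet v' i k t.
Proof. by move=> vv' [ik fi fk e]; split; rewrite // /position !vv'. Qed.

(** Later bullets have no influence: a derivation of [alive v i t] only involves meetings before
    [t], hence bullets fired by then. *)
Lemma eq_alive v v' i t : (forall j, fired j t -> v' j = v j) ->
  alive v i t -> alive v' i t.
Proof.
move=> vv' al; move: v' vv'.
apply: (alive_mut (v := v)
  (P := fun i t _ => forall v', (forall j, fired j t -> v' j = v j) ->
    alive v' i t)
  (P0 := fun i t _ => forall v', (forall j, fired j t -> v' j = v j) ->
    annihilated v' i t)) al => {i t}.
- move=> i t _ IH v' vv'; constructor=> k u ut mt.
  have vv'u j : fired j u -> v' j = v j.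
    by case=> j0 ju; apply: vv'; split=> //; apply: le_trans ju (ltW ut).
  apply: (IH k u ut _ v' vv'u); apply: eq_meet mt => j fj.
  exact/esym/vv'u.
- move=> i k t u ut mt _ IHi _ IHk v' vv'.
  have vv'u j : fired j u -> v' j = v j.
    by case=> j0 ju; apply: vv'; split=> //; apply: le_trans ju (ltW ut).
  apply: (Annihilated ut (eq_meet vv'u mt)); [exact: IHi|exact: IHk].
Qed.

(** A collision is decided by the finitely many bullets fired by its time; this finite witness is
    what makes the event measurable. *)
Lemma killed_local v j : ~ survives v j ->
  exists N, forall v', (forall k, (0 < k < N)%N -> v' k = v k) ->
    ~ survives v' j.
Proof.
move=> /contrapT [i [ji vji [t [mt ali alj]]]].
have [_ [i0 it] [j0 jt] _] := mt.
exists (Num.truncn t).+1 => v' vv'; apply; exists i.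
have vv't k : fired k t -> v' k = v k.
  case=> k0 kt; apply: vv'; rewrite k0 ltnS /=.
  by rewrite truncn_ge_nat// (le_trans _ it).
split=> //; first by rewrite !vv't.
by exists t; split; [exact: eq_meet mt|exact: eq_alive ali|exact: eq_alive alj].
Qed.

(* The trajectory of [b_i] crosses that of [b_k] before it reaches [b_1], so
   by then [b_k] has been annihilated, necessarily by a bullet in between:
   [b_1] stays ahead of [b_k], and nothing overtakes [b_i]. *)
Lemma catches_slow_annihilated v i k : catches v i 1 ->
  (forall l, (0 < l)%N -> v l <= v i) -> (1 < k < i)%N -> 0 <= v k < v 1%N ->
  exists k' u, [/\ (1 < k' < i)%N, meet v k k' u, alive v k u & alive v k' u].
Proof.
move=> [i1 v1i [t [[_ [i0 it] [_ t1] e] ali _]]] vmax /andP[k1 ki].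
move=> /andP[vk0 vk1].
have k1R : 1%:R < k%:R :> R by rewrite ltr_nat.
have kiR : k%:R < i%:R :> R by rewrite ltr_nat.
have k0 : (0 < k)%N by exact: ltn_trans k1.
rewrite /position in e.
(* [u] is the time at which the lines of [b_i] and [b_k] cross. It is at least [i] since [b_k] is
   not behind the origin when [b_i] is fired, and less than [t] since at [t] bullet [b_i] is level
   with [b_1], which is ahead of [b_k]. *)
pose u := (v i * i%:R - v k * k%:R) / (v i - v k).
have vki : 0 < v i - v k by lra.
have uE : v i * (u - i%:R) = v k * (u - k%:R).
  have : (v i - v k) * u = v i * i%:R - v k * k%:R.
    by rewrite /u mulrC divfK// gt_eqF.
  by lra.
have iu : i%:R <= u by rewrite /u ler_pdivlMr//; nra.
have ut : u < t by rewrite /u ltr_pdivrMr//; nra.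
have mik : meet v i k u.
  split=> //; first by lia.
  by split=> //; lra.
have [k' [u' [u'u mkk' alk alk']]] :=
  annihilatedP (alive_annihilated ali ut mik).
exists k', u'; split=> //.
have [kk' [_ ku'] [k'0 k'u'] e'] := mkk'; rewrite /position in e'.
have vmaxk' := vmax _ k'0.
apply/andP; split.
  rewrite ltn_neqAle k'0 andbT; apply/eqP => k'E; subst k'.
  by nra.
(* Before [u], [b_i] is still behind [b_k], and a bullet fired no earlier than [b_i] and no faster
   is not ahead of [b_i]. *)
rewrite ltnNge; apply/negP => ik'.
have ik'R : i%:R <= k'%:R :> R by rewrite ler_nat.
have : v k' * (u' - k'%:R) <= v i * (u' - i%:R) by nra.
by nra.
Qed.

(** Were [l] still alive at a time after [u], its partner [k] would have been annihilated before
    [u]. Applied in both directions, this makes the two collision times equal. *)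
Lemma alive_meet_eq_time v k k' l u u' :
  meet v k l u -> alive v k u -> meet v k' l u' -> alive v l u' -> u' <= u.
Proof.
move=> mkl alk mk'l all; rewrite leNgt; apply/negP => uu'.
exact: alive_not_annihilated alk (alive_annihilated all uu' (meet_sym mkl)).
Qed.

Lemma meet_same_speed v i k t : meet v i k t -> v i = v k -> v i = 0.
Proof.
move=> [ik _ _]; rewrite /position => e vik; apply/eqP; rewrite -[_ == _]negbK.
apply/negP => vi0; apply: ik; apply/eqP; rewrite -(eqr_nat R); apply/eqP.
by move: e; rewrite -vik => /(mulfI vi0); lra.
Qed.

(** Index [j] stands for bullet [j + 2], and [ord_max] for the catcher. Bullets of speed [c] inject
    into the others via their annihilators; the catcher is outside the image, which makes the
    inequality strict. *)
Lemma catches_majority v (c : R) m : 0 < c < v 1%N -> catches v m.+2 1 ->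
  (forall l, (0 < l)%N -> v l <= v m.+2) ->
  (m.+1 < (#|[set j : 'I_m.+1 | v j.+2 != c]%SET|).*2)%N.
Proof.
move=> /andP[c0 c1] ctch vmax.
set J := [set j : 'I_m.+1 | _]%SET.
have [_ v1m _] := ctch.
(* The condition sits under the existential so that [choice] gives a total map; [ord0] is a dummy
   value. *)
have annih (j : 'I_m.+1) : exists x : 'I_m.+1, v j.+2 = c ->
    x \in J :\ ord_max /\ exists u,
    [/\ meet v j.+2 x.+2 u, alive v j.+2 u & alive v x.+2 u].
  have [vjc|/eqP vjc] := eqVneq (v j.+2) c; last by exists ord0 => /vjc.
  have jm : (1 < j.+2 < m.+2)%N.
    rewrite !ltnS /= ltn_neqAle -ltnS ltn_ord andbT.
    by apply/eqP => jm; move: vjc; rewrite jm; lra.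
  have [|k' [u [/andP[k'1 k'm] mt al al']]] :=
    catches_slow_annihilated ctch vmax jm; first by rewrite vjc ltW.
  case: k' k'1 k'm mt al' => [//|[//|k']] _ k'm mt al'.
  have k'm1 : (k' < m.+1)%N by rewrite ltnS ltnW.
  exists (Ordinal k'm1) => _; split; last by exists u.
  rewrite !inE -val_eqE/= ltn_eqF//=.
  apply/eqP => vk'; move: (meet_same_speed mt); rewrite vjc vk' => /(_ erefl).
  by lra.
have [g gP] := choice annih.
have gJ : (#|~: J| <= #|J :\ ord_max|)%N.
  (* Two bullets with the same annihilator meet it at one time and place; having the same nonzero
     speed, they were fired at the same time. *)
  have ginj : {in ~: J &, injective g}.
    move=> x y; rewrite !inE !negbK => /eqP vx /eqP vy gxy.
    have [_ [u [mx alx agx]]] := gP x vx.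
    have [_ [u' [my aly agy]]] := gP y vy.
    rewrite -gxy in my agy.
    have uu' : u = u'.
      apply/le_anti; rewrite (alive_meet_eq_time mx alx my agy).
      by rewrite (alive_meet_eq_time my aly mx agx).
    have [_ _ _ ex] := mx; have [_ _ _ ey] := my.
    move: ex; rewrite uu' -ey /position vx vy => /mulfI exy.
    have /exy : c != 0 by rewrite gt_eqF.
    move=> /(congr1 (fun z => u' - z)); rewrite !subKr => /eqP.
    by rewrite eqr_nat !eqSS => /eqP/val_inj.
  rewrite -(card_in_imset ginj); apply/subset_leq_card.
  apply/fintype.subsetP => _ /imsetP[x xJ ->].
  by apply: (proj1 (gP x _)); move: xJ; rewrite !inE negbK => /eqP.
have mJ : ord_max \in J by rewrite inE gt_eqF//; lra.
have := cardsC J; rewrite card_ord; move: gJ.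
by rewrite (cardsD1 ord_max J) mJ; lia.
Qed.

End Dynamics.

(* A property of the speeds that is witnessed by finitely many of them is a
   countable union of cylinders. *)
Lemma measurable_finitely_witnessed (R : realType) (d : measure_display)
    (T : measurableType d) (X : nat -> {mfun T >-> R}) (s : nat -> R)
    (Q : (nat -> R) -> Prop) :
  (forall k w, (0 < k)%N -> exists j, s j = X k w) ->
  (forall v, Q v -> exists N, forall v',
    (forall k, (0 < k < N)%N -> v' k = v k) -> Q v') ->
  measurable [set w | Q (X ^~ w)].
Proof.
move=> Xs Qfin.
(* Prefixes list indices into [s] rather than speeds, so that they form a countable type; entry 0 is
   a placeholder. *)
pose good (a : seq nat) := forall v,
  (forall k, (0 < k < size a)%N -> v k = s (nth 0%N a k)) -> Q v.
pose cyl (a : seq nat) :=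
  \bigcap_(k in [set k | (0 < k < size a)%N]) X k @^-1` [set s (nth 0%N a k)].
have -> : [set w | Q (X ^~ w)] = \bigcup_(a in good) cyl a.
  apply/seteqP; split=> w /=; last by move=> [a ga wa]; exact: ga.
  move=> /Qfin[N QN].
  have [f fP] : {f : nat -> nat & forall k, (0 < k)%N -> s (f k) = X k w}.
    apply: (@choice _ _ (fun k j => (0 < k)%N -> s j = X k w)) => k.
    have [k0|k0] := ltnP 0%N k; last by exists 0%N.
    by have [j ?] := Xs k w k0; exists j.
  exists (mkseq f N) => [v vf|k /=].
    by apply: QN => k /andP[k0 kN]; rewrite vf ?size_mkseq ?k0// nth_mkseq// fP.
  by rewrite size_mkseq => /andP[k0 kN]; rewrite nth_mkseq// fP.
rewrite bigcup_mkcond; apply: countable_bigcupT_measurable => [|a] //.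
case: ifP => // _.
by apply: bigcap_measurableType => k _; exact: measurable_funPTI.
Qed.

(** * Union bound for a majority of bullets *)

Section MajorityBound.
Context (R : realType) (d : measure_display) (T : measurableType d).
Variables (P : probability T R) (X : nat -> {RV P >-> R}).
Variable mu : probability R R.
Hypothesis X_mu : forall i, (1 < i)%N ->
  forall B, measurable B -> distribution P (X i) B = mu B.
Hypothesis X_indep : independent_RVs [set i | (1 < i)%N] X.

(* More than half of the speeds of bullets 2, ..., m + 2 lie in B. *)
Definition majority_in (B : set R) m : set T :=
  \bigcup_(J in [set J : {set 'I_m.+1} | (m.+1 < (#|J|).*2)%N])
    \bigcap_(i in [set` [seq (val j).+2 | j <- enum J]]) (X i @^-1` B).

Lemma measurable_majority_in B m : measurable B -> measurable (majority_in B m).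
Proof.
move=> mB; apply: fin_bigcup_measurable => // J _.
by apply: bigcap_measurableType => i _; exact: measurable_funPTI.
Qed.

Lemma majority_in_le B m : measurable B -> mu B = (1 / 64)%:E ->
  (P (majority_in B m) <= (2^-1 / (2 ^ m.+1)%:R)%:E)%E.
Proof.
move=> mB muB.
have mcyl (J : {set 'I_m.+1}) : measurable
    (\bigcap_(i in [set` [seq (val j).+2 | j <- enum J]]) (X i @^-1` B)).
  by apply: bigcap_measurableType => i _; exact: measurable_funPTI.
have Pcyl (J : {set 'I_m.+1}) :
    P (\bigcap_(i in [set` [seq (val j).+2 | j <- enum J]]) (X i @^-1` B)) =
    ((1 / 64) ^+ #|J|)%:E.
  rewrite X_indep//.
  - rewrite big_map big_enum/= (eq_bigr (fun=> (1 / 64)%:E)); last first.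
      by move=> j _; rewrite -muB -(@X_mu j.+2).
    by rewrite prodEFin prodr_const.
  - by rewrite map_inj_uniq ?enum_uniq// => x y [] /val_inj.
  - by move=> i /= /mapP[j _ ->].
pose D := enum [pred J : {set 'I_m.+1} | (m.+1 < (#|J|).*2)%N].
have DE : [set J : {set 'I_m.+1} | (m.+1 < (#|J|).*2)%N] = [set` D].
  by apply/seteqP; split=> J /=; rewrite mem_enum.
have := measurable_majority_in m mB; rewrite /majority_in DE => mmaj.
apply: (le_trans (content_sub_fsum P _ _ mmaj (@subset_refl _ _))) => //.
rewrite -fsbig_seq ?enum_uniq// big_enum/=.
(* As [2 * #|J|] exceeds [m + 1], each cylinder has probability at most [(1/8)^(m+1)]; the sum is
   then enlarged to all subsets. *)
apply: (@le_trans _ _ (\sum_(J : {set 'I_m.+1}) ((1 / 8) ^+ m.+1)%:E)%E).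
  rewrite big_mkcond/=; apply: lee_sum => J _; rewrite inE; case: ifPn => mJ.
    rewrite Pcyl lee_fin (_ : 1 / 64 = (1 / 8) ^+ 2) -?exprM; last by field.
    by apply: ler_wiXn2l; [lra|lra|rewrite mul2n ltnW].
  by rewrite lee_fin exprn_ge0//; lra.
rewrite sumEFin lee_fin sumr_const.
rewrite -cardsT -powersetT card_powerset cardsT card_ord.
rewrite -[leLHS]mulr_natl !natrX -exprVn -exprMn.
(* One power of 1/2 is kept for summing over [m]; the other is bounded by 1/2. *)
rewrite (_ : 2 * _ = 2^-1 * 2^-1); last by field.
rewrite exprMn ler_wpM2r// -[leRHS]expr1.
by apply: ler_wiXn2l; rewrite // invf_le1 ?ler1n.
Qed.

End MajorityBound.

(** * Two-point laws *)

Definition pick_speed (R : realType) (a b : R) (x : bool) : R :=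
  if x then a else b.

(* Every set of booleans is measurable. *)
HB.instance Definition _ (R : realType) (a b : R) :=
  isMeasurableFun.Build _ _ _ _ (pick_speed a b) (fun _ _ _ => I).

Section TwoPoint.
Variables (R : realType) (p a b : R).

(** Defined as the image of a Bernoulli law, so that it inherits the structure of a probability. *)
Definition two_point : set R -> \bar R :=
  distribution (bernoulli_prob p) (pick_speed a b).

HB.instance Definition _ := Probability.on two_point.

Lemma two_pointE A : 0 <= p <= 1 ->
  two_point A = (p * (a \in A)%:R + (1 - p) * (b \in A)%:R)%:E.
Proof.
move=> p01; apply: etrans (bernoulli_probE p01 _) _.
by rewrite !diracE.
Qed.

End TwoPoint.

(** * Choice of the measure and survival of the first bullet *)

Theorem theorem2 (R : realType) (n : nat) (s : nat -> R)
  (n_ge3 : (3 <= n)%N)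
  (s_pos : forall i : nat, (1 <= i <= n)%N -> 0 < s i)
  (s_decr : forall i j : nat, (1 <= i)%N -> (i < j)%N -> (j <= n)%N ->
    s j < s i) :
  let S : set R := [set s i | i in [set i : nat | (1 <= i <= n)%N]] in
  exists mu : probability R R,
    [/\ mu S = 1%E,
        (mu [set s 2%N] < mu [set s 1%N])%E
      & forall (d : measure_display) (T : measurableType d)
          (P : probability T R) (X : nat -> {RV P >-> R}),
          conditioned_speeds S mu (s 2%N) X ->
          (0 < P [set w | survives (fun i => X i w) 1%N])%E].

Proof.
move=> S.
have s12 : s 2%N < s 1%N by apply: s_decr; rewrite // ltnW.
have s23 : s 3%N < s 2%N by exact: s_decr.
have s30 : 0 < s 3%N by exact: s_pos.
have p01 : 0 <= (1 / 64 : R) <= 1 by lra.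
pose mu : probability R R := two_point (1 / 64) (s 1%N) (s 3%N).
have muE A : mu A =
    (1 / 64 * (s 1%N \in A)%:R + (1 - 1 / 64) * (s 3%N \in A)%:R)%:E.
  exact: two_pointE.
exists mu; split.
- have S1 : S (s 1%N) by exists 1%N => //=; lia.
  have S3 : S (s 3%N) by exists 3%N.
  by rewrite muE !mem_set// !mulr1 addrC subrK.
- rewrite !muE lte_fin !in_set1 eqxx.
  rewrite (gt_eqF s12) (lt_eqF s23) (lt_eqF (lt_trans s23 s12)) /= !mulr0.
  by lra.
move=> d T P X [XS X1 Xmu Xind].
have Xs k w : (0 < k)%N -> exists j, s j = X k w.
  by move=> k0; have [j _ jX] := XS k w k0; exists j.
have Xle k w : (0 < k)%N -> X k w <= s 1%N.
  move=> k0; have [j /andP[j1 jn] <-] := XS k w k0.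
  move: j1; rewrite leq_eqVlt => /predU1P[<-//|j1].
  by apply/ltW/s_decr.
have Xfast k w : (0 < k)%N -> s 2%N < X k w -> X k w = s 1%N.
  move=> k0; have [[|[|[|j]]] /andP[j1 jn] <-] := XS k w k0 => //.
    by rewrite ltxx.
  by rewrite ltNge ltW// s_decr.
pose killed := [set w | ~ survives (X ^~ w) 1].
(* The majority lemma counts the bullets whose speed is not [s 3], hence a complement; under [mu] it
   has the mass of [s 1]. *)
pose B : set R := ~` [set s 3%N].
have mB : measurable B by exact: measurableC.
have muB : mu B = (1 / 64)%:E.
  rewrite muE !in_setC !in_set1 eqxx gt_eqF/=; last exact: lt_trans s12.
  by rewrite mulr1 mulr0 addr0.
have mkilled : measurable killed.
  apply: (measurable_finitely_witnessed (Q := fun v => ~ survives v 1) Xs) => v.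
  exact: killed_local.
have -> : [set w | survives (X ^~ w) 1] = ~` killed.
  by apply/seteqP; split=> w /=; rewrite notK.
rewrite probability_setC//.
(* The first speed is [s 2] only almost surely; [N] is the exceptional null event. *)
pose N := X 1%N @^-1` (~` [set s 2%N]).
have mN : measurable N by exact/measurable_funPTI/measurableC.
have PN : P N = 0%E.
  rewrite /N -preimage_setC probability_setC; first by rewrite X1 subee.
  exact: measurable_funPTI.
have mmaj k : measurable (majority_in X B k) by exact: measurable_majority_in.
have killedN : killed `<=` N `|` \bigcup_k majority_in X B k.
  move=> w /contrapT[i ci].
  have [v1|v1] := eqVneq (X 1%N w) (s 2%N); last first.
    by left; apply/eqP.
  right; have [i1 v1i _] := ci.
  case: i i1 v1i ci => [//|[//|m]] _; rewrite v1 => v1i ci.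
  exists m => //.
  have := @catches_majority _ _ (s 3%N) _ _ ci.
  rewrite v1 s30 s23 => /(_ isT) half.
  (* The catcher is faster than [s 2], so it has the maximal speed [s 1], as the majority lemma
     requires. *)
  exists [set j : 'I_m.+1 | X j.+2 w != s 3%N]%SET.
    apply: half => l l0; rewrite (Xfast m.+2)//; exact: Xle.
  move=> _ /= /mapP[j + ->]; rewrite mem_enum inE => /eqP.
  exact.
have Pkilled : (P killed <= (2^-1)%:E)%E.
  apply: (@le_trans _ _ (P (N `|` \bigcup_k majority_in X B k))).
    apply: le_measure; rewrite ?inE//.
    by apply: measurableU => //; exact: bigcup_measurable.
  apply: (@le_trans _ _ (P N + P (\bigcup_k majority_in X B k))%E).
    by apply: measureU2 => //; exact: bigcup_measurable.
  rewrite PN add0e.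
  apply: le_trans (measure_sigma_subadditive _ mmaj _ (@subset_refl _ _)) _.
    exact: bigcup_measurable.
  (* The geometric bounds [(1/2) / 2^(k+1)] sum to 1/2. *)
  apply: le_trans (epsilon_trick0 xpredT _); last by [].
  by apply: lee_nneseries => // k _; exact: (majority_in_le Xmu Xind).
rewrite sube_gt0; apply: le_lt_trans Pkilled _.
by rewrite lte_fin; lra.
Qed.
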